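(* Let $M$ be an $n$-dimensional complex manifold endowed with a holomorphic Riemannian metric $g$ admitting a holomorphic metric volume form $\omega_g$. Let $h$ be the anti-Kählerian metric on the underlying real manifold given by the real part of $g$ and $k$ its twin metric (as defined in the context). Let $f\in\mathcal{O}(M)$ be nowhere vanishing and let $\alpha\in\mathcal{O}(M)$. Then $\alpha$ is a holomorphic last multiplier for $\mathrm{grad}_g(\log f)$ if and only if $|\alpha|^2$ is a real last multiplier for both real vector fields $\frac{1}{|f|^2}\,\mathrm{grad}_h|f|^2$ and $\frac{1}{|f|^2}\,\mathrm{grad}_k|f|^2$.
   Context: A holomorphic Riemannian metric $g$ on $M$ is a holomorphic section of $\odot^2(T^{1,0}M)^*$ that is nondegenerate at each point; locally $g=\sum g_{jk}\,dz^jdz^k$ with $g_{jk}=g_{kj}$ holomorphic and $\det(g_{jk})\ne 0$. A holomorphic metric volume form $\omega_g$ is a global holomorphic $n$-form with $\omega_g(E_1,\dots,E_n)=\pm1$ for every local holomorphic frame with $g(E_j,E_k)=\delta_{jk}$. For a holomorphic function $u$, the holomorphic gradient $\mathrm{grad}_g u$ is the holomorphic vector field with $g(W,\mathrm{grad}_g u)=W(u)$ for all holomorphic vector fields $W$. The field $\mathrm{grad}_g(\log f)$ means $\frac1f\,\mathrm{grad}_g f$, i.e. locally $\frac1f\sum_{i,j}g^{ij}\frac{\partial f}{\partial z^i}\frac{\partial}{\partial z^j}$ with $(g^{ij})=(g_{ij})^{-1}$ (independent of the choice of branch of $\log f$). Let $J$ be the complex structure of $M$. The real metric $h$ (pseudo-Riemannian)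 is $h(X,Y)=2\,\mathrm{Re}\,g(X^{1,0},Y^{1,0})$ for real tangent vectors $X,Y$, where $X^{1,0}=\frac12(X-iJX)$. Thus, with $z^j=x^j+ix^{n+j}$, $h(\partial/\partial x^i,\partial/\partial x^j)=2\,\mathrm{Re}\,g_{ij}$ and $h(\partial/\partial x^i,\partial/\partial x^{n+j})=-2\,\mathrm{Im}\,g_{ij}$. The twin metric is $k(X,Y)=h(JX,Y)=h(X,JY)$. $\mathrm{grad}_hu$ and $\mathrm{grad}_ku$ are the gradients of a smooth real function $u$ with respect to $h$ and $k$. $\alpha\in\mathcal{O}(M)$ is a holomorphic last multiplier for a holomorphic vector field $Z$ if $\partial(\alpha\,\imath_Z\omega_g)=0$, where $d=\partial+\overline\partial$. $m\in C^\infty(M;\mathbb{R})$ is a real last multiplier for a real vector field $X$ if $d(m\,\imath_X(\omega_g\wedge\overline{\omega_g}))=0$. *)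

(* Defs.v *)
From HB Require Import structures.
From mathcomp Require Export all_boot all_order all_fingroup all_algebra.
From mathcomp Require Export complex.
From mathcomp Require Export all_classical all_reals all_analysis.

Set Implicit Arguments.
Unset Strict Implicit.
Unset Printing Implicit Defensive.

Import Order.TTheory GRing.Theory Num.Theory numFieldNormedType.Exports.

Local Open Scope ring_scope.
Local Open Scope complex_scope.
Local Open Scope classical_set_scope.

(** * Calculus on open subsets of C^n

  C^n is modelled on R^(n+n), with z^j = x^j + i x^(n+j).  A vector of
  'rV[R]_(n+n) is a point or a real tangent vector, with components in the
  frame d/dx^a.  A vector of 'rV[R[i]]_(n+n) is a complexified tangent vector,
  with components in the frame d/dz^1, .., d/dz^n, d/dzbar^1, .., d/dzbar^n. *)

Section Calculus.
Variables (R : realType) (n : nat).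
Local Notation C := R[i].
Local Notation V := 'rV[R]_(n + n).
Local Notation VC := 'rV[C]_(n + n).
Implicit Types (U : set V) (F : V -> C) (x : V).

Definition reF F : V -> R := fun x => complex.Re (F x).
Definition imF F : V -> R := fun x => complex.Im (F x).

(* Meaningful for open U only. *)
Fixpoint Ck (k : nat) U (f : V -> R) : Prop :=
  if k is k'.+1 then
    (forall x, U x -> differentiable f x) /\
    (forall v : V, Ck k' U (fun x => 'D_v f x))
  else forall x, U x -> {for x, continuous f}.

Definition smooth_on U (f : V -> R) := forall k, Ck k U f.

Definition e_ (a : 'I_(n + n)) : V := delta_mx 0 a.

Definition dx (a : 'I_(n + n)) F x : C :=
  'D_(e_ a) (reF F) x +i* 'D_(e_ a) (imF F) x.

Definition dz (j : 'I_n) F x : C :=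
  (dx (lshift n j) F x - 'i * dx (rshift n j) F x) / 2%:R.

Definition dzbar (j : 'I_n) F x : C :=
  (dx (lshift n j) F x + 'i * dx (rshift n j) F x) / 2%:R.

Definition holomorphic_on U F : Prop :=
  [/\ smooth_on U (reF F), smooth_on U (imF F) &
      forall x, U x -> forall j, dzbar j F x = 0].

(* The coordinates z of a point x; also, the components of the (1,0)-part
   X^{1,0} = (X - i J X)/2 of a real tangent vector X in the frame d/dz^j. *)
Definition zc (X : V) : 'rV[C]_n :=
  \row_j (X 0 (lshift n j) +i* X 0 (rshift n j)).

Definition Jc (X : V) : V := row_mx (- rsubmx X) (lsubmx X).

Definition vec10 (Z : 'rV[C]_n) : VC := row_mx Z 0.

Definition part10 (v : VC) : VC := row_mx (lsubmx v) 0.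

Definition conj_vec (v : VC) : VC :=
  row_mx (map_mx conjc (rsubmx v)) (map_mx conjc (lsubmx v)).

(* The real vector X as X^{1,0} + conj X^{1,0}. *)
Definition realvec (X : V) : VC := row_mx (zc X) (map_mx conjc (zc X)).

(* The derivative of F along a complexified tangent vector. *)
Definition ddir (v : VC) F x : C :=
  \sum_(j < n) (v 0 (lshift n j) * dz j F x + v 0 (rshift n j) * dzbar j F x).

(** Complex valued differential forms, as functions of complexified vectors. *)

Definition form (k : nat) := V -> ('I_k -> VC) -> C.

Definition scale_form k (u : V -> C) (eta : form k) : form k :=
  fun x v => u x * eta x v.

Definition conj_form k (eta : form k) : form k :=
  fun x v => (eta x (fun a => conj_vec (v a)))^*.

Definition wedge k l (eta : form k) (theta : form l) : form (k + l) :=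
  fun x v => (k`!%:R * l`!%:R)^-1 *
    \sum_(s : 'S_(k + l)) (-1) ^+ s *
      (eta x (fun a => v (s (lshift l a))) *
       theta x (fun b => v (s (rshift k b)))).

(* Interior product with a complexified vector field, inserted as the first
   argument; it vanishes on forms of degree 0. *)
Definition interior k (Z : V -> VC) : form k -> form k.-1 :=
  match k return form k -> form k.-1 with
  | 0 => fun _ _ _ => 0
  | k'.+1 => fun eta x v =>
      eta x (fun a => if unlift ord0 a is Some b then v b else Z x)
  end.

(* Vectors are extended to fields with constant components in the coordinate
   frame, whose brackets vanish. *)
Definition extd k (eta : form k) : form k.+1 :=
  fun x v => \sum_(a < k.+1) (-1) ^+ a *
    ddir (v a) (fun y => eta y (fun b => v (lift a b))) x.

(* If eta = sum u_IJ dz^I dzbar^J, this is sum (d u_IJ)^{1,0} dz^I dzbar^J: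
   only the derivatives along d/dz^j are kept. *)
Definition del k (eta : form k) : form k.+1 :=
  fun x v => \sum_(a < k.+1) (-1) ^+ a *
    ddir (part10 (v a)) (fun y => eta y (fun b => v (lift a b))) x.

(* The form w dz^1 /\ .. /\ dz^n. *)
Definition top_form (w : V -> C) : form n :=
  fun x v => w x * \det (\matrix_(a < n, b < n) v a 0 (lshift n b)).

(** Bilinear forms and gradients *)

Definition bil (G : 'M[C]_n) (u v : 'rV[C]_n) : C := (u *m G *m v^T) 0 0.

Definition real_bil (G : 'M[C]_n) (X Y : V) : R :=
  2%:R * complex.Re (bil G (zc X) (zc Y)).

Definition twin_bil (G : 'M[C]_n) (X Y : V) : R := real_bil G (Jc X) Y.

Definition gram (B : V -> V -> R) : 'M[R]_(n + n) :=
  \matrix_(a, b) B (e_ a) (e_ b).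

End Calculus.

(* The vector representing the covector c; see [sharpP]. *)
Definition sharp (F : fieldType) (m : nat) (G : 'M[F]_m) (c : 'rV[F]_m) :
  'rV[F]_m := c *m (invmx G)^T.

Lemma sharpP (F : fieldType) (m : nat) (G : 'M[F]_m) (c v : 'rV[F]_m) :
  G \in unitmx ->
  (forall w : 'rV[F]_m, w *m G *m v^T = w *m c^T) <-> v = sharp G c.
Proof.
move=> Gu; split=> [H|-> w].
  have E : G *m v^T = c^T.
    by apply/row_matrixP => i; rewrite !rowE mulmxA H.
  by apply: trmx_inj; rewrite /sharp trmx_mul trmxK -E mulmxA mulVmx // mul1mx.
by rewrite /sharp trmx_mul trmxK mulmxA mulmxK.
Qed.

Section Nondegenerate.
Variables (R : realType) (n : nat).
Local Notation C := R[i].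
Local Notation V := 'rV[R]_(n + n).

Lemma zcD (X Y : V) : zc (X + Y) = zc X + zc Y.
Proof. by apply/rowP => j; rewrite !mxE /=; simpc. Qed.

Lemma zcZ (a : R) (X : V) : zc (a *: X) = a%:C *: zc X.
Proof. by apply/rowP => j; rewrite !mxE /=; simpc. Qed.

Lemma zc0 : zc (0 : V) = 0.
Proof. by apply/rowP => j; rewrite !mxE. Qed.

Lemma zcJ (X : V) : zc (Jc X) = 'i *: zc X.
Proof.
apply/rowP => j; rewrite mxE [RHS]mxE [zc X 0 j]mxE /Jc.
by rewrite row_mxEl row_mxEr !mxE; simpc.
Qed.

Lemma zc_inj (X : V) : zc X = 0 -> X = 0.
Proof.
move=> /rowP H; apply/rowP => a; rewrite mxE -(splitK a).
by case: (fintype.split a) => b /=; have := H b; rewrite !mxE; case.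
Qed.

Lemma zc_surj (u : 'rV[C]_n) : exists X : V, zc X = u.
Proof.
exists (row_mx (map_mx (@complex.Re R) u) (map_mx (@complex.Im R) u)).
apply/rowP => j; rewrite mxE row_mxEl row_mxEr !mxE.
by case: (u 0 j).
Qed.

Lemma real_bil_gram (G : 'M[C]_n) (X Y : V) :
  (X *m gram (real_bil G) *m Y^T) 0 0 = real_bil G X Y.
Proof.
have zcE (T : V) : zc T = \sum_a (T 0 a)%:C *: zc (e_ R a).
  rewrite {1}(row_sum_delta T).
  elim/big_rec2: _ => [|a y y' _ <-]; first exact: zc0.
  by rewrite zcD zcZ.
have ReM (r : R) (z : C) : complex.Re (r%:C * z) = r * complex.Re z.
  by case: z => a b /=; rewrite mul0r subr0.
have Re_sum (I : finType) (f : I -> C) :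
    complex.Re (\sum_i f i) = \sum_i complex.Re (f i).
  exact: (raddf_sum (@complex.Re R : {additive _ -> _})).
rewrite /real_bil (zcE X) (zcE Y) /bil linear_sum mulmx_sumr summxE Re_sum.
rewrite mxE mulr_sumr; apply: eq_bigr => b _.
rewrite [in RHS]linearZ /= -scalemxAr [X in complex.Re X]mxE ReM mulrCA.
rewrite [Y^T b 0]mxE mulrC; congr (_ * _).
rewrite [in RHS]mulmx_suml [in RHS]mulmx_suml summxE Re_sum mulr_sumr.
rewrite mxE; apply: eq_bigr => a _.
by rewrite -!scalemxAl [X in complex.Re X]mxE ReM mxE mulrCA.
Qed.

Lemma gram_real_unit (G : 'M[C]_n) :
  \det G != 0 -> gram (real_bil G) \in unitmx.
Proof.
move=> G0; rewrite -row_free_unit -kermx_eq0; apply/eqP/row_matrixP => r.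
rewrite row0; set X := row r _.
have X0 : X *m gram (real_bil G) = 0 by apply/sub_kermxP; exact: row_sub.
have H Y : real_bil G X Y = 0 by rewrite -real_bil_gram X0 mul0mx mxE.
have HC Y : bil G (zc X) (zc Y) = 0.
  have := H Y; have := H (Jc Y).
  rewrite /real_bil zcJ {1}/bil linearZ /= -scalemxAr mxE -/(bil _ _ _).
  case: (bil _ _ _) => a b /=; rewrite mul0r mul1r sub0r.
  move=> /eqP; rewrite mulf_eq0 pnatr_eq0 /= oppr_eq0 => /eqP ->.
  by move=> /eqP; rewrite mulf_eq0 pnatr_eq0 /= => /eqP ->.
apply: zc_inj; apply: (can_inj (mulmxK (_ : G \in unitmx))).
  by rewrite unitmxE unitfE.
rewrite mul0mx; apply/rowP => j; have [Y HY] := zc_surj (delta_mx 0 j).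
have := HC Y; rewrite HY /bil trmx_delta -colE mxE => ->.
by rewrite mxE.
Qed.

Lemma gram_twin_unit (G : 'M[C]_n) :
  \det G != 0 -> gram (twin_bil G) \in unitmx.
Proof.
move=> G0; have G1 : \det ('i *: G) != 0.
  rewrite detZ mulf_neq0 // expf_neq0 // eq_complex /= oner_eq0 andbF //.
rewrite (_ : gram _ = gram (real_bil ('i *: G))); first exact: gram_real_unit.
apply/matrixP => a b; rewrite !mxE /twin_bil /real_bil zcJ /bil.
by rewrite -scalemxAl -scalemxAr.
Qed.

End Nondegenerate.

(** * Complex manifolds *)

(* A chart is given by its real coordinates; [chart_inv] only matters on the
   image of the chart. *)
Record complexManifold (R : realType) (n : nat) := ComplexManifold {
  carrier :> topologicalType ;
  carrier_hausdorff : hausdorff_space carrier ;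
  carrier_second_countable : @second_countable carrier ;
  chart_index : Type ;
  chart_dom : chart_index -> set carrier ;
  chart : chart_index -> carrier -> 'rV[R]_(n + n) ;
  chart_inv : chart_index -> 'rV[R]_(n + n) -> carrier ;
  chart_dom_open : forall i, open (chart_dom i) ;
  chart_cover : forall p, exists i, chart_dom i p ;
  chart_im_open : forall i, open (chart i @` chart_dom i) ;
  chartK : forall i p, chart_dom i p -> chart_inv i (chart i p) = p ;
  chart_continuous : forall i p, chart_dom i p ->
    {for p, continuous (chart i)} ;
  chart_inv_continuous : forall i x, (chart i @` chart_dom i) x ->
    {for x, continuous (chart_inv i)} ;
  transition_holomorphic : forall i j (b : 'I_n),
    holomorphic_on (chart i @` (chart_dom i `&` chart_dom j))
      (fun x => zc (chart j (chart_inv i x)) 0 b)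
}.

Section Manifold.
Variables (R : realType) (n : nat) (M : complexManifold R n).
Local Notation C := R[i].
Local Notation V := 'rV[R]_(n + n).
Local Notation VC := 'rV[C]_(n + n).
Local Notation I := (chart_index M).

Definition chart_im (i : I) : set V := chart i @` chart_dom i.

Definition overlap (i j : I) : set V :=
  chart i @` (chart_dom i `&` chart_dom j).

Definition transition (i j : I) (x : V) : V := chart j (chart_inv i x).

(* The entry (a, b) is dz_j^b / dz_i^a. *)
Definition jacobian (i j : I) (x : V) : 'M[C]_n :=
  \matrix_(a, b) dz a (fun y => zc (transition i j y) 0 b) x.

Definition holomorphic (f : M -> C) : Prop :=
  forall i, holomorphic_on (chart_im i) (f \o chart_inv i).

Definition smooth (m : M -> R) : Prop :=
  forall i, smooth_on (chart_im i) (m \o chart_inv i).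

(** Tensors are given by their components in each chart, subject to the
    transformation law on overlaps. *)

Record holoMetric := HoloMetric {
  gmx :> I -> V -> 'M[C]_n ;
  gmx_holo : forall i a b, holomorphic_on (chart_im i) (fun x => gmx i x a b) ;
  gmx_sym : forall i x, chart_im i x -> (gmx i x)^T = gmx i x ;
  gmx_nondeg : forall i x, chart_im i x -> \det (gmx i x) != 0 ;
  gmx_compat : forall i j x, overlap i j x ->
    gmx i x =
      jacobian i j x *m gmx j (transition i j x) *m (jacobian i j x)^T
}.

(* [wco i] is the coefficient of dz_i^1 /\ .. /\ dz_i^n. *)
Record metricVolume (g : holoMetric) := MetricVolume {
  wco :> I -> V -> C ;
  wco_holo : forall i, holomorphic_on (chart_im i) (wco i) ;
  wco_compat : forall i j x, overlap i j x ->
    wco i x = \det (jacobian i j x) * wco j (transition i j x) ;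
  wco_frame : forall i (W : set V) (E : 'I_n -> V -> 'rV[C]_n),
    open W -> W `<=` chart_im i ->
    (forall a b, holomorphic_on W (fun x => E a x 0 b)) ->
    (forall x, W x -> forall a b, bil (g i x) (E a x) (E b x) = (a == b)%:R) ->
    forall x, W x ->
      let t := top_form (wco i) x (fun a => vec10 (E a x)) in t = 1 \/ t = -1
}.

Definition hfield := I -> V -> 'rV[C]_n.

Definition rfield := I -> V -> V.

Definition metric_form (g : holoMetric) (w : metricVolume g) (i : I) :
  form R n n := top_form (w i).

Definition holo_last_multiplier (g : holoMetric) (w : metricVolume g)
    (alpha : M -> C) (Z : hfield) : Prop :=
  holomorphic alpha /\
  forall i x, chart_im i x -> forall v : 'I_(n.-1).+1 -> VC,
    del (scale_form (alpha \o chart_inv i)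
          (interior (fun y => vec10 (Z i y)) (metric_form w i))) x v = 0.

Definition real_last_multiplier (g : holoMetric) (w : metricVolume g)
    (m : M -> R) (X : rfield) : Prop :=
  smooth m /\
  forall i x, chart_im i x -> forall v : 'I_((n + n).-1).+1 -> VC,
    extd (scale_form (fun y => (m (chart_inv i y))%:C)
           (interior (fun y => realvec (X i y))
             (wedge (metric_form w i) (conj_form (metric_form w i))))) x v = 0.

Definition hgrad (g : holoMetric) (u : M -> C) : hfield := fun i x =>
  sharp (g i x) (\row_j dz j (u \o chart_inv i) x).

Definition hgrad_log (g : holoMetric) (f : M -> C) : hfield := fun i x =>
  (f (chart_inv i x))^-1 *: hgrad g f i x.

Definition differential (u : M -> R) (i : I) (x : V) : V :=
  \row_a 'D_(e_ R a) (u \o chart_inv i) x.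

Definition grad_h (g : holoMetric) (u : M -> R) : rfield := fun i x =>
  sharp (gram (real_bil (g i x))) (differential u i x).

Definition grad_k (g : holoMetric) (u : M -> R) : rfield := fun i x =>
  sharp (gram (twin_bil (g i x))) (differential u i x).

Definition sqmod (f : M -> C) : M -> R := fun p => ComplexField.Normc.normc (f p) ^+ 2.

Definition scale_field (u : M -> R) (X : rfield) : rfield := fun i x =>
  u (chart_inv i x) *: X i x.

End Manifold.

(* Main.v *)
From mathcomp Require Import ring.
Require Import Defs.

Local Open Scope ring_scope.

(** Work in a chart, with w the coefficient of the volume form, Z the components
    of grad_g (log f) and B = alpha w, a holomorphic function.

    Contracting a top form with a field and differentiating gives the divergence
    of the field with respect to that form ([del_interior], [extd_interior]).
    Hence alpha is a holomorphic last multiplier iff E = sum_j d(B Z^j)/dz^j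
    vanishes, and |alpha|^2 is a real one for a real field X iff the Euclidean
    divergence of |B|^2 X vanishes, the form w dz /\ conj (w dz) being |w|^2 times
    the standard volume form ([wedge_top_form]).

    The metric h is twice the real part of g, so the (1,0)-part of an h-gradient is
    the g-gradient of the (1,0)-part of the differential; for u = |f|^2 the latter
    is conj(f) df.  So the field built with h has (1,0)-part Z, and the one built
    with k, twice the real part of i g, has (1,0)-part - i Z ([zc_real_gradient],
    [zc_twin_gradient]).  As conj B is antiholomorphic, the divergences of |B|^2
    times these fields are 2 Re (conj(B) E) and 2 Re (- i conj(B) E)
    ([divergence_real_gradient]).  Both vanish iff conj(B) E = 0.

    It remains to cancel conj(B), which may have zeros.  If E is nonzero at a point
    it is nonzero nearby, so B vanishes nearby, and E, which involves only B Z and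
    its derivatives, vanishes at that point ([div_eq0]). *)

Set Implicit Arguments.
Unset Strict Implicit.
Unset Printing Implicit Defensive.

Import Order.TTheory GRing.Theory Num.Theory numFieldNormedType.Exports.

(** * Functions of class C^k *)

(** Differentiability only depends on the germ: the differential of [f] satisfies
    the first order expansion of [g]. *)
Lemma near_eq_differentiable (K : numFieldType) (V W : normedModType K)
    (f g : V -> W) (x : V) :
  {near x, f =1 g} -> differentiable f x -> differentiable g x.
Proof.
move=> fg /diff_locallyP[dfc df].
have fgx : f x = g x := nbhs_singleton fg.
have dg : g \o shift x = cst (g x) + 'd f x +o_ 0 id.
  apply/eqaddoP => e e0; move/eqaddoP/(_ e e0): df.
  have : \forall h \near 0, f (h + x) = g (h + x).
    by move: fg; rewrite (near_shift 0 x)/= subr0.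
  by apply: filterS2 => h /= E; rewrite -fgx !fctE /= E.
have Dg : 'd g x = 'd f x :> (V -> W) by exact: diff_unique.
by apply/diff_locallyP; rewrite Dg.
Qed.

Section CkTheory.
Local Open Scope complex_scope.
Local Open Scope classical_set_scope.
Variables (R : realType) (n : nat).
Local Notation V := 'rV[R]_(n + n).
Variable U : set V.
Hypothesis oU : open U.
Implicit Types (f g : V -> R) (x : V).

Lemma near_open_eq (T : Type) (f g : V -> T) x :
  U x -> (forall y, U y -> f y = g y) -> {near x, f =1 g}.
Proof.
by move=> Ux fg; apply: filterS (open_nbhs_nbhs (conj oU Ux)).
Qed.

(** The derivatives of a sum, product or inverse agree with the expressions given
    by the rules of calculus on [U] only, so the inductions below need [Ck] to be
    insensitive to the values outside the open set [U]. *)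
Lemma Ck_eq k f g : (forall x, U x -> f x = g x) -> Ck k U f -> Ck k U g.
Proof.
elim: k f g => [|k IH] f g fg /=.
  move=> cf x Ux; have nfg := near_open_eq Ux fg.
  suff: g @ x --> g x by [].
  rewrite -(fg x Ux); exact: cvg_trans (near_eq_cvg nfg) (cf x Ux).
move=> [df Df]; split=> [x Ux|v].
  exact: near_eq_differentiable (near_open_eq Ux fg) (df x Ux).
apply: IH (Df v) => x Ux; apply: near_eq_derive.
exact: near_open_eq Ux fg.
Qed.

Lemma Ck_le k f : Ck k.+1 U f -> Ck k U f.
Proof.
elim: k f => [|k IH] f [df Df].
  by move=> x Ux; apply: differentiable_continuous (df x Ux).
by split=> // v; apply: IH (Df v).
Qed.

Lemma Ck_cst k (a : R) : Ck k U (cst a).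
Proof.
elim: k a => [|k IH] a /=; first by move=> x _; exact: cst_continuous.
split=> [x _ //|v]; apply: Ck_eq (IH 0) => x _.
by rewrite derive_cst.
Qed.

Lemma CkD k f g : Ck k U f -> Ck k U g -> Ck k U (f + g).
Proof.
elim: k f g => [|k IH] f g /=.
  by move=> cf cg x Ux; apply: continuousD; [exact: cf|exact: cg].
move=> [df Df] [dg Dg]; split=> [x Ux|v].
  by apply: differentiableD; [exact: df|exact: dg].
apply: Ck_eq (IH _ _ (Df v) (Dg v)) => x Ux.
by rewrite deriveD //; apply: diff_derivable; [exact: df|exact: dg].
Qed.

Lemma CkM k f g : Ck k U f -> Ck k U g -> Ck k U (f * g).
Proof.
elim: k f g => [|k IH] f g.
  by move=> cf cg x Ux; apply: continuousM; [exact: cf|exact: cg].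
move=> Cf Cg; have [df Df] := Cf; have [dg Dg] := Cg; split=> [x Ux|v].
  by apply: differentiableM; [exact: df|exact: dg].
have := CkD (IH _ _ (Ck_le Cf) (Dg v)) (IH _ _ (Ck_le Cg) (Df v)).
apply: Ck_eq => x Ux.
by rewrite deriveM //; apply: diff_derivable; [exact: df|exact: dg].
Qed.

Lemma CkN k f : Ck k U f -> Ck k U (- f).
Proof.
move=> Cf; apply: Ck_eq (CkM (Ck_cst k (-1)) Cf) => x _.
by rewrite !fctE /= mulN1r.
Qed.

Lemma CkV k f : (forall x, U x -> f x != 0) -> Ck k U f ->
  Ck k U (fun x => (f x)^-1).
Proof.
move=> f0; elim: k => [|k IH].
  by move=> cf x Ux; apply: continuousV; [exact: f0|exact: cf].
move=> Cf; have [df Df] := Cf; split=> [x Ux|v].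
  by apply: differentiableV; [exact: df|exact: f0].
have Ci := IH (Ck_le Cf).
apply: Ck_eq (CkN (CkM (CkM Ci Ci) (Df v))) => x Ux.
rewrite deriveV ?f0//; last exact: diff_derivable (df x Ux).
by rewrite !fctE /= scaleNr expr2 invfM.
Qed.

End CkTheory.

(** * Wirtinger derivatives *)

Section Wirtinger.
Local Open Scope complex_scope.
Local Open Scope classical_set_scope.
Variables (R : realType) (n : nat).
Local Notation C := R[i].
Local Notation V := 'rV[R]_(n + n).
Local Notation VC := 'rV[C]_(n + n).
Implicit Types (U : set V) (F G : V -> C) (x : V).

Definition differentiableC F x : Prop :=
  differentiable (reF F) x /\ differentiable (imF F) x.

Lemma reFM F G :
  reF (fun y => F y * G y) = reF F * reF G - imF F * imF G.
Proof.
by apply/funext => y; rewrite /reF /imF !fctE; case: (F y) (G y) => ? ? [].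
Qed.

Lemma imFM F G :
  imF (fun y => F y * G y) = reF F * imF G + imF F * reF G.
Proof.
by apply/funext => y; rewrite /reF /imF !fctE; case: (F y) (G y) => ? ? [].
Qed.

Lemma reFD F G : reF (fun y => F y + G y) = reF F + reF G.
Proof.
by apply/funext => y; rewrite /reF !fctE; case: (F y) (G y) => ? ? [].
Qed.

Lemma imFD F G : imF (fun y => F y + G y) = imF F + imF G.
Proof.
by apply/funext => y; rewrite /imF !fctE; case: (F y) (G y) => ? ? [].
Qed.

Lemma reF_conj F : reF (fun y => (F y)^*%C) = reF F.
Proof. by apply/funext => y; rewrite /reF; case: (F y). Qed.

Lemma imF_conj F : imF (fun y => (F y)^*%C) = - imF F.
Proof. by apply/funext => y; rewrite /imF !fctE; case: (F y). Qed.

Lemma differentiableC_cst (a : C) x : differentiableC (fun=> a) x.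
Proof. by split; exact: differentiable_cst. Qed.

Lemma differentiableCD F G x : differentiableC F x -> differentiableC G x ->
  differentiableC (fun y => F y + G y) x.
Proof.
by move=> [? ?] [? ?]; split; rewrite ?reFD ?imFD; exact: differentiableD.
Qed.

Lemma differentiableCM F G x : differentiableC F x -> differentiableC G x ->
  differentiableC (fun y => F y * G y) x.
Proof.
move=> [? ?] [? ?]; split; rewrite ?reFM ?imFM.
  by apply: differentiableB; exact: differentiableM.
by apply: differentiableD; exact: differentiableM.
Qed.

Lemma differentiableC_conj F x : differentiableC F x ->
  differentiableC (fun y => (F y)^*%C) x.
Proof.
move=> [? ?]; split; rewrite ?reF_conj ?imF_conj //; exact: differentiableN.
Qed.

Lemma near_eq_differentiableC F G x : {near x, F =1 G} ->
  differentiableC F x -> differentiableC G x.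
Proof.
move=> FG [rF iF]; split.
  apply: near_eq_differentiable rF.
  by apply: filterS FG => y; rewrite /reF => ->.
apply: near_eq_differentiable iF.
by apply: filterS FG => y; rewrite /imF => ->.
Qed.

Lemma near_eq_dx (a : 'I_(n + n)) F G x : {near x, F =1 G} ->
  dx a F x = dx a G x.
Proof.
move=> FG; congr (_ +i* _); apply: near_eq_derive;
  by move: FG; apply: filterS => y; rewrite /reF /imF => ->.
Qed.

Lemma dx_cst (a : 'I_(n + n)) (c : C) x : dx a (fun=> c) x = 0.
Proof. by rewrite /dx /reF /imF !derive_cst. Qed.

Lemma dxD (a : 'I_(n + n)) F G x : differentiableC F x -> differentiableC G x ->
  dx a (fun y => F y + G y) x = dx a F x + dx a G x.
Proof.
move=> [rF iF] [rG iG]; rewrite /dx reFD imFD !deriveD;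
  try exact: diff_derivable.
by simpc.
Qed.

Lemma dxM (a : 'I_(n + n)) F G x : differentiableC F x -> differentiableC G x ->
  dx a (fun y => F y * G y) x = dx a F x * G x + F x * dx a G x.
Proof.
move=> [rF iF] [rG iG]; rewrite /dx reFM imFM.
rewrite deriveB ?deriveD ?deriveM;
  try by [exact: diff_derivable | apply: derivableM; exact: diff_derivable].
rewrite /reF /imF; case: (F x) (G x) => [p q] [r s] /=.
by simpc; congr (_ +i* _); rewrite /GRing.scale /=; ring.
Qed.

Lemma dx_conj (a : 'I_(n + n)) F x : differentiableC F x ->
  dx a (fun y => (F y)^*%C) x = (dx a F x)^*%C.
Proof.
by move=> [rF iF]; rewrite /dx reF_conj imF_conj deriveN //;
  exact: diff_derivable.
Qed.

(** The derivative along the [c]-th vector of the frame d/dz^1, .., d/dz^n,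
    d/dzbar^1, .., d/dzbar^n, so that both families are treated at once. *)
Definition dw (c : 'I_(n + n)) F x : C :=
  match fintype.split c with inl j => dz j F x | inr j => dzbar j F x end.

Lemma dw_l j F x : dw (lshift n j) F x = dz j F x.
Proof. by rewrite /dw (unsplitK (inl j)). Qed.

Lemma dw_r j F x : dw (rshift n j) F x = dzbar j F x.
Proof. by rewrite /dw (unsplitK (inr j)). Qed.

Lemma ddirE (v : VC) F x : ddir v F x = \sum_c v 0 c * dw c F x.
Proof.
rewrite big_split_ord /= /ddir big_split /=.
by congr (_ + _); apply: eq_bigr => j _; rewrite ?dw_l ?dw_r.
Qed.

(** The rules of calculus for [dw c] follow from those for [dx] by linearity. *)
Lemma dw_dxE c : exists a b k l, forall F x,
  dw c F x = a * dx k F x + b * dx l F x.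
Proof.
rewrite /dw; case: fintype.split => j.
  exists 2%:R^-1, (- ('i / 2%:R)), (lshift n j), (rshift n j) => F x.
  by rewrite /dz mulrC mulrDr mulNr mulrN mulrA [_^-1 * 'i]mulrC.
exists 2%:R^-1, ('i / 2%:R), (lshift n j), (rshift n j) => F x.
by rewrite /dzbar mulrC mulrDr mulrA [_^-1 * 'i]mulrC.
Qed.

Lemma near_eq_dw c F G x : {near x, F =1 G} -> dw c F x = dw c G x.
Proof.
have [a [b [k [l E]]]] := dw_dxE c.
by move=> FG; rewrite !E !(near_eq_dx _ FG).
Qed.

Lemma dw_cst c (z : C) x : dw c (fun=> z) x = 0.
Proof.
by have [a [b [k [l ->]]]] := dw_dxE c; rewrite !dx_cst !mulr0 addr0.
Qed.

Lemma dwD c F G x : differentiableC F x -> differentiableC G x ->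
  dw c (fun y => F y + G y) x = dw c F x + dw c G x.
Proof.
have [a [b [k [l E]]]] := dw_dxE c.
by move=> dF dG; rewrite !E !dxD // !mulrDr addrACA.
Qed.

Lemma dwM c F G x : differentiableC F x -> differentiableC G x ->
  dw c (fun y => F y * G y) x = dw c F x * G x + F x * dw c G x.
Proof.
have [a [b [k [l E]]]] := dw_dxE c.
move=> dF dG; rewrite !E !dxM // !mulrDr mulrDl -!mulrA addrACA.
by rewrite ![F x * (_ * _)]mulrCA.
Qed.

Lemma conjcM (a b : C) : (a * b)^*%C = a^*%C * b^*%C.
Proof. exact: rmorphM. Qed.

Lemma conjcD (a b : C) : (a + b)^*%C = a^*%C + b^*%C.
Proof. exact: rmorphD. Qed.

Lemma dz_conj j F x : differentiableC F x ->
  dz j (fun y => (F y)^*%C) x = (dzbar j F x)^*%C.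
Proof.
move=> dF; rewrite /dz /dzbar !dx_conj // conjcM conjcD conjcM.
have -> : ('i : C)^*%C = - 'i by simpc.
by rewrite conjc_inv conjc_nat mulNr.
Qed.

Lemma dzbar_conj j F x : differentiableC F x ->
  dzbar j (fun y => (F y)^*%C) x = (dz j F x)^*%C.
Proof.
move=> dF; have := dz_conj j (differentiableC_conj dF).
rewrite (_ : (fun y => _) = F); last by apply/funext => y; rewrite conjcK.
by move=> ->; rewrite conjcK.
Qed.

Lemma differentiableC_sum (I : Type) (r : seq I) (Y : I -> V -> C) x :
  (forall c, differentiableC (Y c) x) ->
  differentiableC (fun y => \sum_(c <- r) Y c y) x.
Proof.
move=> dY; elim: r => [|c r IH].
  rewrite (_ : (fun y => _) = fun=> 0); first exact: differentiableC_cst.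
  by apply/funext => y; rewrite big_nil.
rewrite (_ : (fun y => _) = fun y => Y c y + \sum_(c <- r) Y c y).
  exact: differentiableCD.
by apply/funext => y; rewrite big_cons.
Qed.

Lemma dw_sum (I : Type) (r : seq I) c (Y : I -> V -> C) x :
  (forall c, differentiableC (Y c) x) ->
  dw c (fun y => \sum_(i <- r) Y i y) x = \sum_(i <- r) dw c (Y i) x.
Proof.
move=> dY; elim: r => [|i r IH].
  rewrite (_ : (fun y => _) = fun=> 0); first by rewrite dw_cst big_nil.
  by apply/funext => y; rewrite big_nil.
rewrite (_ : (fun y => _) = fun y => Y i y + \sum_(i <- r) Y i y); last first.
  by apply/funext => y; rewrite big_cons.
rewrite dwD //; last exact: differentiableC_sum.
by rewrite IH big_cons.
Qed.

Lemma ddir_sumMr (I : finType) (v : VC) (Y : I -> V -> C) (k : I -> C) x :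
  (forall c, differentiableC (Y c) x) ->
  ddir v (fun y => \sum_i Y i y * k i) x = \sum_i ddir v (Y i) x * k i.
Proof.
move=> dY; under [RHS]eq_bigr do rewrite ddirE mulr_suml.
rewrite exchange_big ddirE; apply: eq_bigr => c _ /=.
rewrite dw_sum; last first.
  by move=> i; apply: differentiableCM => //; exact: differentiableC_cst.
rewrite mulr_sumr; apply: eq_bigr => i _.
rewrite dwM //; last exact: differentiableC_cst.
by rewrite dw_cst mulr0 addr0 mulrA.
Qed.

Definition CkC k U F : Prop := Ck k U (reF F) /\ Ck k U (imF F).

Section Open.
Variable U : set V.
Hypothesis oU : open U.

Lemma CkC_differentiable k F x : CkC k.+1 U F -> U x -> differentiableC F x.
Proof. by move=> [[rF _] [iF _]] Ux; split; [exact: rF|exact: iF]. Qed.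

Lemma CkC_eq k F G : (forall x, U x -> F x = G x) -> CkC k U F -> CkC k U G.
Proof.
move=> FG [rF iF]; split.
  by apply: (Ck_eq oU) rF => x Ux; rewrite /reF FG.
by apply: (Ck_eq oU) iF => x Ux; rewrite /imF FG.
Qed.

Lemma CkC_cst k (a : C) : CkC k U (fun=> a).
Proof. by split; exact: Ck_cst. Qed.

Lemma CkCD k F G : CkC k U F -> CkC k U G -> CkC k U (fun y => F y + G y).
Proof. by move=> [? ?] [? ?]; split; rewrite ?reFD ?imFD; exact: CkD. Qed.

Lemma CkCM k F G : CkC k U F -> CkC k U G -> CkC k U (fun y => F y * G y).
Proof.
move=> [? ?] [? ?]; split; rewrite ?reFM ?imFM; apply: CkD => //;
  by [exact: CkM|apply: CkN => //; exact: CkM].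
Qed.

Lemma CkCV k F : (forall x, U x -> F x != 0) -> CkC k U F ->
  CkC k U (fun y => (F y)^-1).
Proof.
move=> F0 [rF iF].
have CN := CkD oU (CkM oU rF rF) (CkM oU iF iF).
have N0 x : U x -> (reF F * reF F + imF F * imF F) x != 0.
  move=> /F0; apply: contra; rewrite !fctE /reF /imF; case: (F x) => a b /=.
  rewrite -!expr2 paddr_eq0 ?sqr_ge0 // !sqrf_eq0 => /andP[/eqP -> /eqP ->].
  by [].
have CV := CkV oU N0 CN.
split.
  apply: (Ck_eq oU) (CkM oU rF CV) => x Ux.
  by rewrite !fctE /reF /imF; case: (F x) => a b /=; rewrite -!expr2.
apply: (Ck_eq oU) (CkN oU (CkM oU iF CV)) => x Ux.
by rewrite !fctE /reF /imF; case: (F x) => a b /=; rewrite -!expr2.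
Qed.

Lemma CkC_sum k (I : Type) (r : seq I) (P : pred I) (Y : I -> V -> C) :
  (forall i, CkC k U (Y i)) -> CkC k U (fun y => \sum_(i <- r | P i) Y i y).
Proof.
move=> dY; elim: r => [|i r IH].
  by apply: CkC_eq (CkC_cst k 0) => y _; rewrite big_nil.
have [Pi|/negbTE Pi] := boolP (P i); last first.
  by apply: CkC_eq IH => y _; rewrite big_cons Pi.
by apply: CkC_eq (CkCD (dY i) IH) => y _; rewrite big_cons Pi.
Qed.

Lemma CkC_prod k (I : Type) (r : seq I) (Y : I -> V -> C) :
  (forall i, CkC k U (Y i)) -> CkC k U (fun y => \prod_(i <- r) Y i y).
Proof.
move=> dY; elim: r => [|i r IH].
  by apply: CkC_eq (CkC_cst k 1) => y _; rewrite big_nil.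
by apply: CkC_eq (CkCM (dY i) IH) => y _; rewrite big_cons.
Qed.

Lemma CkC_det k m (A : V -> 'M[C]_m) :
  (forall i j, CkC k U (fun y => A y i j)) -> CkC k U (fun y => \det (A y)).
Proof.
move=> CA; rewrite /determinant; apply: CkC_sum => s.
apply: CkCM; first exact: CkC_cst.
by apply: CkC_prod.
Qed.

Lemma CkC_dx k a F : CkC k.+1 U F -> CkC k U (dx a F).
Proof. by move=> [[_ rF] [_ iF]]; split; [exact: rF|exact: iF]. Qed.

Lemma CkC_dz k j F : CkC k.+1 U F -> CkC k U (dz j F).
Proof.
move=> CF; apply: CkCM; last exact: CkC_cst.
apply: CkC_eq (CkCD (CkC_dx (lshift n j) CF)
  (CkCM (CkC_cst k (- 'i)) (CkC_dx (rshift n j) CF))) => x _.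
by rewrite mulNr.
Qed.

Lemma CkC_invmx k m (A : V -> 'M[C]_m) i j :
  (forall x, U x -> \det (A x) != 0) ->
  (forall i j, CkC k U (fun y => A y i j)) -> CkC k U (fun y => invmx (A y) i j).
Proof.
move=> A0 CA.
have : CkC k U (fun y => (\det (A y))^-1 * \adj (A y) i j).
  apply: CkCM; first by apply: CkCV => //; exact: CkC_det.
  apply: (@CkC_eq _ (fun y => (-1) ^+ (j + i) * \det (row' j (col' i (A y))))).
    by move=> y _; rewrite mxE.
  apply: CkCM; first exact: CkC_cst.
  apply: CkC_det => a b.
  by apply: CkC_eq (CA (lift j a) (lift i b)) => y _; rewrite !mxE.
apply: CkC_eq => y Uy; rewrite /invmx unitmxE unitfE A0 //.
by rewrite [RHS]mxE.
Qed.

End Open.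
End Wirtinger.

(** * Determinants *)

Section Det.
Variable K : comPzRingType.

(** A Laplace expansion along the first [n] columns, in which every shuffle is
    counted n!^2 times.  Expanding the two minors over permutations [p] and [q],
    the sum over [s] is, for fixed [p] and [q], the determinant of [v] with its
    columns permuted by [p] and [q] blockwise; its sign cancels theirs. *)
Lemma det_shuffle (n : nat) (v : 'M[K]_(n + n)) :
  \sum_(s : 'S_(n + n)) (-1) ^+ s *
    (\det (\matrix_(a < n, b < n) v (s (lshift n a)) (lshift n b)) *
     \det (\matrix_(a < n, b < n) v (s (rshift n a)) (rshift n b)))
  = (n`!%:R * n`!%:R) * \det v.
Proof.
pose B (p q : 'S_n) : 'M[K]_(n + n) := block_mx (perm_mx p) 0 0 (perm_mx q).
transitivity (\sum_(p : 'S_n) \sum_(q : 'S_n)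
    ((-1) ^+ p * (-1) ^+ q) * \det (B p q *m v^T)).
  under eq_bigr do rewrite /determinant mulr_suml mulr_sumr.
  rewrite exchange_big; apply: eq_bigr => p _ /=.
  under eq_bigr do rewrite mulr_sumr mulr_sumr.
  rewrite exchange_big; apply: eq_bigr => q _ /=.
  rewrite /determinant mulr_sumr; apply: eq_bigr => s _.
  rewrite big_split_ord /=.
  have El a c : (B p q *m v^T) (lshift n a) c = v c (lshift n (p a)).
    rewrite mxE big_split_ord /= (bigD1 (p a)) //= big1 ?addr0; last first.
      by move=> b ba; rewrite block_mxEul !mxE eq_sym (negbTE ba) mul0r.
    rewrite [X in _ + X]big1 ?addr0 => [|b _]; last first.
      by rewrite block_mxEur !mxE mul0r.
    by rewrite block_mxEul !mxE eqxx mul1r.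
  have Er a c : (B p q *m v^T) (rshift n a) c = v c (rshift n (q a)).
    rewrite mxE big_split_ord /= big1 ?add0r => [|b _]; last first.
      by rewrite block_mxEdl !mxE mul0r.
    rewrite (bigD1 (q a)) //= big1 ?addr0; last first.
      by move=> b ba; rewrite block_mxEdr !mxE eq_sym (negbTE ba) mul0r.
    by rewrite block_mxEdr !mxE eqxx mul1r.
  under eq_bigr do rewrite mxE.
  under [\prod_i (\matrix_(_, _) _) _ _]eq_bigr do rewrite mxE.
  under [X in _ = _ * (_ * (X * _))]eq_bigr do rewrite El.
  under [X in _ = _ * (_ * (_ * X))]eq_bigr do rewrite Er.
  by rewrite [in LHS]mulrACA [LHS]mulrCA.
have E (p q : 'S_n) : (-1) ^+ p * (-1) ^+ q * \det (B p q *m v^T) = \det v.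
  rewrite det_mulmx det_tr det_ublock !det_perm mulrA.
  by rewrite mulrACA -!expr2 !sqrr_sign !mul1r.
under eq_bigr do under eq_bigr do rewrite E.
rewrite !sumr_const card_Sn -mulrnA -natrM.
by rewrite -[LHS]mulr_natl.
Qed.

(** Both sides are the trace of [v *m T *m \adj v]. *)
Lemma sum_mulmx_cofactor (N : nat) (v T : 'M[K]_N) :
  \sum_a \sum_c (v *m T) a c * cofactor v a c = \tr T * \det v.
Proof.
transitivity (\tr (v *m T *m \adj v)).
  apply: eq_bigr => a _; rewrite [RHS]mxE; apply: eq_bigr => c _.
  by rewrite [\adj v c a]mxE.
by rewrite -mulmxA mxtrace_mulC -mulmxA mul_adj_mx mul_mx_scalar mxtraceZ mulrC.
Qed.

(** Row [a] of [v] is deleted and [Y] becomes the first row: the matrix of the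
    arguments of a top form after contraction with [Y], in the [a]-th term of an
    exterior derivative. *)
Definition row_insert (N : nat) (Y : 'I_N.+1 -> K) (v : 'M[K]_N.+1)
    (a : 'I_N.+1) : 'M[K]_N.+1 :=
  \matrix_(r, c) if unlift ord0 r is Some b then v (lift a b) c else Y c.

Lemma det_row_insert N (Y : 'I_N.+1 -> K) (v : 'M[K]_N.+1) (a : 'I_N.+1) :
  (-1) ^+ a * \det (row_insert Y v a) = \sum_c Y c * cofactor v a c.
Proof.
rewrite (expand_det_row _ ord0) mulr_sumr; apply: eq_bigr => c _.
rewrite !mxE unlift_none /cofactor /= add0n mulrCA; congr (_ * _).
rewrite mulrA -exprD; congr (_ * \det _).
by apply/matrixP => i j; rewrite !mxE liftK.
Qed.

Lemma det_row_insertZ N (k : K) (Y : 'I_N.+1 -> K)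
    (v : 'M[K]_N.+1) (a : 'I_N.+1) :
  \det (row_insert (fun c => k * Y c) v a) = k * \det (row_insert Y v a).
Proof.
rewrite -[LHS](signrMK a) -[X in _ = k * X](signrMK a) !det_row_insert.
rewrite mulrCA; congr (_ * _); rewrite mulr_sumr.
by apply: eq_bigr => c _; rewrite -mulrA.
Qed.

End Det.

(** * Exterior derivatives of contracted top forms *)

Section Forms.
Local Open Scope complex_scope.
Local Open Scope classical_set_scope.
Variables (R : realType) (n : nat).
Local Notation C := R[i].
Local Notation V := 'rV[R]_(n + n).
Local Notation VC := 'rV[C]_(n + n).
Implicit Types (w : V -> C) (x : V).

(** In terms of all the components, w dz /\ conj (w dz) is |w|^2 times the standard
    volume form dz^1 /\ .. /\ dz^n /\ dzbar^1 /\ .. /\ dzbar^n. *)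
Lemma wedge_top_form w x (v : 'I_(n + n) -> VC) :
  wedge (top_form w) (conj_form (top_form w)) x v =
  w x * (w x)^*%C * \det (\matrix_(a, b) v a 0 b).
Proof.
have conj_top (u : 'I_n -> VC) : conj_form (top_form w) x u =
    (w x)^*%C * \det (\matrix_(a, b) u a 0 (rshift n b)).
  rewrite /conj_form /top_form conjcM -(det_map_mx (@conjc R)).
  congr (_ * \det _); apply/matrixP => a b.
  rewrite [RHS]mxE -[RHS]conjcK mxE; congr conjc.
  by rewrite mxE row_mxEl mxE; congr conjc; rewrite mxE.
have fact0 : (n`!%:R * n`!%:R : C) != 0.
  by rewrite mulf_neq0 // pnatr_eq0 -lt0n fact_gt0.
rewrite /wedge; apply: (mulfI fact0); rewrite mulVKf //.
rewrite [RHS]mulrCA -det_shuffle mulr_sumr; apply: eq_bigr => s _.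
rewrite conj_top /top_form [X in _ * X = _]mulrACA [LHS]mulrCA.
do 2!congr (_ * _); congr (_ * _); apply: (congr1 determinant);
  by apply/matrixP => a b; rewrite !mxE.
Qed.

(** The identity d(i_Y dx) = div Y dx for the volume form dx of the coordinates.
    The entry (d, c) of [T] is the derivative of [Y c] in the [d]-th direction, and
    the cofactors that appear on expanding along the inserted row are constant. *)
Lemma sum_ddir_det N (Y : 'I_N.+1 -> V -> C) (v T : 'M[C]_N.+1)
    (u : 'I_N.+1 -> VC) x :
  (forall c, differentiableC (Y c) x) ->
  (forall a c, ddir (u a) (Y c) x = (v *m T) a c) ->
  \sum_(a < N.+1) (-1) ^+ a *
    ddir (u a) (fun y => \det (row_insert (Y^~ y) v a)) x = \tr T * \det v.
Proof.
move=> dY uT; rewrite -sum_mulmx_cofactor; apply: eq_bigr => a _.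
rewrite (_ : (fun y => _) =
    fun y => \sum_c Y c y * ((-1) ^+ a * cofactor v a c)); last first.
  apply/funext => y; rewrite -[LHS](signrMK a) det_row_insert mulr_sumr.
  by apply: eq_bigr => c _; rewrite mulrCA.
rewrite ddir_sumMr // mulr_sumr; apply: eq_bigr => c _.
by rewrite uT mulrCA signrMK.
Qed.
End Forms.

Section Divergence.
Local Open Scope complex_scope.
Local Open Scope classical_set_scope.
Variables (R : realType) (n : nat).
Local Notation C := R[i].
Local Notation V := 'rV[R]_(n.+1 + n.+1).
Local Notation VC := 'rV[C]_(n.+1 + n.+1).
Implicit Types (w : V -> C) (x : V).

(** The form is div (A w Z) times dz^1 /\ .. /\ dz^n, so evaluating it on the frame
    d/dz^j recovers the divergence. *)
Lemma del_interior (A w : V -> C) (Z : V -> 'rV[C]_n.+1) x :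
  (forall j, differentiableC (fun y => A y * w y * Z y 0 j) x) ->
  (forall v : 'I_n.+1 -> VC,
    del (scale_form A (interior (fun y => vec10 (Z y)) (top_form w))) x v = 0) <->
  \sum_j dz j (fun y => A y * w y * Z y 0 j) x = 0.
Proof.
move=> dY.
have EY (v : 'I_n.+1 -> VC) a y :
    scale_form A (interior (fun y => vec10 (Z y)) (top_form w)) y
      (fun b => v (lift a b)) =
    \det (row_insert (fun c => A y * w y * Z y 0 c)
      (\matrix_(a, b) v a 0 (lshift n.+1 b)) a).
  rewrite det_row_insertZ -mulrA; apply: (congr1 (fun z => _ * (_ * z))).
  apply: (congr1 determinant); apply/matrixP => r c; rewrite [LHS]mxE [RHS]mxE.
  by case: unliftP => [b|] _; [rewrite [RHS]mxE|exact: row_mxEl].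
have E (v : 'I_n.+1 -> VC) :
    del (scale_form A (interior (fun y => vec10 (Z y)) (top_form w))) x v =
    (\sum_j dz j (fun y => A y * w y * Z y 0 j) x) *
    \det (\matrix_(a < n.+1, b < n.+1) v a 0 (lshift n.+1 b)).
  pose T := \matrix_(d, c) dz d (fun y => A y * w y * Z y 0 c) x.
  have -> : \sum_j dz j (fun y => A y * w y * Z y 0 j) x = \tr T.
    by apply: eq_bigr => j _; rewrite mxE.
  rewrite -(sum_ddir_det (u := fun a => part10 (v a)) dY); last first.
    move=> a c; rewrite mxE; apply: eq_bigr => d _.
    by rewrite /part10 row_mxEl row_mxEr ![_ _ _ (_ : 'I_n.+1)]mxE mul0r addr0.
  rewrite /del; apply: eq_bigr => a _.
  apply: (congr1 (fun F => (-1) ^+ a * ddir (part10 (v a)) F x)).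
  by apply/funext => y; exact: EY.
split=> [H|H v]; last by rewrite E H mul0r.
have := H (fun a => vec10 (delta_mx 0 a)); rewrite E.
rewrite (_ : \matrix_(a, b) _ = 1%:M) ?det1 ?mulr1 //.
by apply/matrixP => a b; rewrite [LHS]mxE row_mxEl !mxE eqxx /= eq_sym.
Qed.

(** The same in the frame d/dz^j, d/dzbar^j of the complexified tangent space, where
    the components of a real field are those of its (1,0)-part and their
    conjugates. *)
Lemma extd_interior (m w : V -> C) (X : V -> V) x :
  (forall c, differentiableC
     (fun y => m y * (w y * (w y)^*%C) * realvec (X y) 0 c) x) ->
  (forall v : 'I_(n.+1 + n.+1) -> VC,
    extd (scale_form m (interior (fun y => realvec (X y))
      (wedge (top_form w) (conj_form (top_form w))))) x v = 0) <->
  \sum_c dw c (fun y => m y * (w y * (w y)^*%C) * realvec (X y) 0 c) x = 0.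
Proof.
move=> dY.
have EY (v : 'I_(n.+1 + n.+1) -> VC) a y :
    scale_form m (interior (fun y => realvec (X y))
      (wedge (top_form w) (conj_form (top_form w)))) y
      (fun b => v (lift a b)) =
    \det (row_insert (fun c => m y * (w y * (w y)^*%C) * realvec (X y) 0 c)
      (\matrix_(a, b) v a 0 b) a).
  rewrite det_row_insertZ -mulrA /scale_form; apply: (congr1 (fun z => _ * z)).
  etransitivity; first exact: wedge_top_form.
  apply: (congr1 (fun z => _ * z)).
  apply: (congr1 determinant); apply/matrixP => r c; rewrite [LHS]mxE [RHS]mxE.
  by case: unliftP => [b|] _; [rewrite [RHS]mxE|].
have E (v : 'I_(n.+1 + n.+1) -> VC) :
    extd (scale_form m (interior (fun y => realvec (X y))
      (wedge (top_form w) (conj_form (top_form w))))) x v =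
    (\sum_c dw c (fun y => m y * (w y * (w y)^*%C) * realvec (X y) 0 c) x) *
    \det (\matrix_(a < n.+1 + n.+1, b < n.+1 + n.+1) v a 0 b).
  pose T := \matrix_(d, c)
    dw d (fun y => m y * (w y * (w y)^*%C) * realvec (X y) 0 c) x.
  have -> : \sum_c dw c
      (fun y => m y * (w y * (w y)^*%C) * realvec (X y) 0 c) x = \tr T.
    by apply: eq_bigr => j _; rewrite mxE.
  rewrite -(@sum_ddir_det _ _ (n + n.+1) _ _ _ v _ dY); last first.
    move=> a c; rewrite mxE ddirE; apply: eq_bigr => d _.
    by rewrite !mxE.
  rewrite /extd; apply: eq_bigr => a _.
  apply: (congr1 (fun F => (-1) ^+ a * ddir (v a) F x)).
  by apply/funext => y; exact: EY.
split=> [H|H v]; last by rewrite E H mul0r.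
have := H (fun a => delta_mx 0 a); rewrite E.
rewrite (_ : \matrix_(a, b) _ = 1%:M) ?det1 ?mulr1 //.
by apply/matrixP => a b; rewrite !mxE eqxx /= eq_sym.
Qed.
End Divergence.

(** * Real and holomorphic gradients *)

Section Gradients.
Local Open Scope complex_scope.
Local Open Scope classical_set_scope.
Variables (R : realType) (n : nat).
Local Notation C := R[i].
Local Notation V := 'rV[R]_(n + n).
Implicit Types (G : 'M[C]_n) (F B : V -> C) (x : V).

(** The components c(d/dz^j) of the real covector [c]. *)
Definition covector10 (c : V) : 'rV[C]_n :=
  \row_j (((c 0 (lshift n j))%:C - 'i * (c 0 (rshift n j))%:C) / 2%:R).

Lemma real_pairing (W c : V) :
  2%:R * complex.Re ((zc W *m (covector10 c)^T) 0 0) = (W *m c^T) 0 0.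
Proof.
have ReB (z t : C) : complex.Re (z + t) = complex.Re z + complex.Re t.
  by case: z t => [? ?] [].
have Re2 (z : C) : 2%:R * complex.Re z = complex.Re (2%:R * z).
  by rewrite !mulr_natl !mulr2n ReB.
have Re_sum (I : finType) (f : I -> C) :
    complex.Re (\sum_i f i) = \sum_i complex.Re (f i).
  exact: (raddf_sum (@complex.Re R : {additive _ -> _})).
have half2 (z t : C) : 2%:R * (z * (t / 2%:R)) = z * t.
  by rewrite mulrCA [2%:R * _]mulrC mulfVK ?pnatr_eq0.
rewrite Re2 !mxE big_split_ord /= mulr_sumr Re_sum -big_split /=.
apply: eq_bigr => j _; rewrite !mxE half2.
by simpc.
Qed.

(** The (1,0)-part of a gradient for h is a gradient for g: the equation
    2 Re g(W, X) = c(W) = 2 Re c(W^{1,0}) for all real W is solved by the X whose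
    (1,0)-part represents the (1,0)-part of c. *)
Lemma zc_sharp_real G (c : V) : \det G != 0 ->
  zc (sharp (gram (real_bil G)) c) = sharp G (covector10 c).
Proof.
move=> G0; have [Y HY] := zc_surj (sharp G (covector10 c)).
rewrite -HY; congr zc; apply/esym/sharpP; first exact: gram_real_unit.
move=> W; apply/matrixP => i j; rewrite !ord1 real_bil_gram /real_bil /bil HY.
have Gu : G \in unitmx by rewrite unitmxE unitfE.
by rewrite ((sharpP _ _ Gu).2 erefl) real_pairing.
Qed.

Lemma gram_twin G : gram (twin_bil G) = gram (real_bil ('i *: G)).
Proof.
apply/matrixP => a b; rewrite !mxE /twin_bil /real_bil zcJ /bil.
by rewrite -scalemxAl -scalemxAr.
Qed.

(** As i g(W, X) = g(JW, X), the twin of g is the real metric of i g, whose inverse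
    is that of g divided by i. *)
Lemma zc_sharp_twin G (c : V) : \det G != 0 ->
  zc (sharp (gram (twin_bil G)) c) = - 'i *: sharp G (covector10 c).
Proof.
move=> G0; have i0 : 'i != 0 :> C by exact: neq0Ci.
rewrite gram_twin zc_sharp_real; last by rewrite detZ mulf_neq0 // expf_neq0.
rewrite /sharp invmxZ; last by rewrite unitmxE unitfE detZ mulf_neq0 // expf_neq0.
by rewrite linearZ /= -scalemxAr invCi.
Qed.

Lemma dz_real (u : V -> R) j x :
  dz j (fun y => (u y)%:C) x = covector10 (\row_a 'D_(e_ R a) u x) 0 j.
Proof.
rewrite /dz /dx !mxE (_ : imF _ = cst 0) // !derive_cst.
by rewrite (_ : reF _ = u).
Qed.

Lemma normc_sqrE (z : C) : (ComplexField.Normc.normc z ^+ 2)%:C = z * z^*%C.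
Proof.
case: z => a b; rewrite sqr_sqrtr ?addr_ge0 ?sqr_ge0 //; simpc.
by rewrite -!expr2 [b * a]mulrC addNr.
Qed.

Lemma covector10_sqmod F x : differentiableC F x ->
  (forall j, dzbar j F x = 0) ->
  covector10 (\row_a
    'D_(e_ R a) (fun y => ComplexField.Normc.normc (F y) ^+ 2) x) =
  (F x)^*%C *: \row_j dz j F x.
Proof.
move=> dF F0; apply/rowP => j; rewrite -dz_real.
rewrite (_ : (fun y => _) = fun y => F y * (F y)^*%C); last first.
  by apply/funext => y; exact: normc_sqrE.
rewrite -dw_l dwM //; last exact: differentiableC_conj.
by rewrite !dw_l dz_conj // F0 conjc0 mulr0 addr0 !mxE mulrC.
Qed.

(** Divergence of |B|^2 X for a real field X with (1,0)-part lam Z.  Since conj B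
    is antiholomorphic, d/dz^j passes it by, and the (1,0)-part of |B|^2 X
    contributes lam conj(B) div (B Z); the (0,1)-part contributes the conjugate. *)
Lemma sum_dw_real_field B (Z : V -> 'rV[C]_n) (X : V -> V) (H : V -> C)
    (lam : C) x :
  differentiableC B x -> (forall j, dzbar j B x = 0) ->
  (forall j, differentiableC (fun y => B y * Z y 0 j) x) ->
  (\forall y \near x, H y = B y * (B y)^*%C) ->
  (\forall y \near x, zc (X y) = lam *: Z y) ->
  let q := lam * ((B x)^*%C * \sum_j dz j (fun y => B y * Z y 0 j) x) in
  (forall c, differentiableC (fun y => H y * realvec (X y) 0 c) x) /\
  \sum_c dw c (fun y => H y * realvec (X y) 0 c) x = q + q^*%C.
Proof.
move=> dB B0 dBZ HB XZ q.
have AC (b z l c : C) : b * z * (l * c) = b * c * (l * z).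
  by rewrite -!mulrA; congr (_ * _); rewrite mulrCA [z * c]mulrC mulrCA.
pose L j y := B y * Z y 0 j * (lam * (B y)^*%C).
have dL j : differentiableC (L j) x.
  apply: differentiableCM; first exact: dBZ.
  apply: differentiableCM; first exact: differentiableC_cst.
  exact: differentiableC_conj.
have El j : {near x, L j =1 (fun y => H y * realvec (X y) 0 (lshift n j))}.
  apply: filterS2 HB XZ => y -> XZy; rewrite row_mxEl XZy mxE /L.
  exact: AC.
have Er j : {near x, (fun y => (L j y)^*%C) =1
    (fun y => H y * realvec (X y) 0 (rshift n j))}.
  apply: filterS2 HB XZ => y -> XZy; rewrite row_mxEr mxE XZy mxE /L.
  by rewrite AC conjcM [in LHS]conjcM conjcK [_ * B y]mulrC.
split=> [c|].
  rewrite -(splitK c); case: (fintype.split c) => j /=.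
    exact: near_eq_differentiableC (El j) (dL j).
  by apply: near_eq_differentiableC (Er j) _; exact: differentiableC_conj.
have EL : \sum_j dz j (L j) x = q.
  rewrite /q !mulr_sumr; apply: eq_bigr => j _.
  rewrite -dw_l dwM //; last first.
    apply: differentiableCM; first exact: differentiableC_cst.
    exact: differentiableC_conj.
  rewrite [dw _ (fun y => lam * _) _]dwM //;
    [|exact: differentiableC_cst|exact: differentiableC_conj].
  rewrite dw_cst mul0r add0r [dw _ (fun y => (B y)^*%C) _]dw_l.
  rewrite dz_conj // B0 conjc0 !mulr0 addr0.
  by rewrite dw_l mulrC mulrA.
rewrite big_split_ord /=; congr (_ + _).
  by rewrite -EL; apply: eq_bigr => j _; rewrite -(near_eq_dw _ (El j)) dw_l.
rewrite -EL (rmorph_sum (@conjc R)); apply: eq_bigr => j _.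
by rewrite -(near_eq_dw _ (Er j)) dw_r dzbar_conj.
Qed.

(** The factor conj(B) can be cancelled although B may vanish: if div (B Z) is
    nonzero at x then, being continuous, it is nonzero near x, hence B = 0 near x,
    and then div (B Z) = 0 at x. *)
Lemma div_eq0 (U : set V) B (Z : V -> 'rV[C]_n) : open U ->
  (forall j, CkC 1 U (fun y => B y * Z y 0 j)) ->
  (forall x, U x -> (B x)^*%C * \sum_j dz j (fun y => B y * Z y 0 j) x = 0) ->
  forall x, U x -> \sum_j dz j (fun y => B y * Z y 0 j) x = 0.
Proof.
move=> oU CBZ BE x Ux; apply/eqP; apply: contraT => Ex0.
pose E x := \sum_j dz j (fun y => B y * Z y 0 j) x.
have [cr ci] : CkC 0 U E by apply: CkC_sum => // j; exact: CkC_dz.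
have nE : \forall y \near x, E y != 0.
  have : (reF E x != 0) || (imF E x != 0).
    apply: contraR Ex0; rewrite negb_or !negbK -/(E x) /reF /imF.
    by case: (E x) => a b /= /andP[/eqP -> /eqP ->].
  case/orP => H0.
    apply: filterS (cvgr_neq0 _ (cr x Ux) H0) => y; apply: contra => /eqP.
    by rewrite /reF => ->.
  apply: filterS (cvgr_neq0 _ (ci x Ux) H0) => y; apply: contra => /eqP.
  by rewrite /imF => ->.
have nB : \forall y \near x, B y = 0.
  apply: filterS2 nE (open_nbhs_nbhs (conj oU Ux)) => y Ey0 Uy.
  by have /eqP := BE y Uy; rewrite mulf_eq0 (negbTE Ey0) orbF conjc_eq0 => /eqP.
case/negP: Ex0; apply/eqP; rewrite big1 // => j _.
rewrite -[RHS](dw_cst (lshift n j) 0 x) -dw_l; apply: near_eq_dw.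
by apply: filterS nB => y ->; rewrite mul0r.
Qed.

Lemma re_im_eq0 (q : C) :
  q + q^*%C = 0 -> - 'i * q + (- 'i * q)^*%C = 0 -> q = 0.
Proof.
case: q => a b; simpc => /eqP.
rewrite eq_complex /= -mulr2n mulrn_eq0 /= => /andP[/eqP -> _].
move/eqP; rewrite eq_complex /= -mulr2n mulrn_eq0 /= => /andP[/eqP -> _].
by [].
Qed.
End Gradients.

(** * Last multipliers *)

Section Chart.
Local Open Scope complex_scope.
Local Open Scope classical_set_scope.
Variables (R : realType) (n : nat).
Local Notation C := R[i].
Local Notation V := 'rV[R]_(n + n).
Implicit Types (x : V).
Local Notation normc := (ComplexField.Normc.normc).

Lemma sharpZ m (G : 'M[C]_m) (a : C) (c : 'rV[C]_m) :
  sharp G (a *: c) = a *: sharp G c.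
Proof. by rewrite /sharp scalemxAl. Qed.

Lemma holomorphic_CkC k (U : set V) (F : V -> C) :
  holomorphic_on U F -> CkC k U F.
Proof. by move=> [rF iF _]; split; [exact: rF|exact: iF]. Qed.

Lemma smooth_sqnorm (U : set V) (F : V -> C) : open U ->
  holomorphic_on U F -> smooth_on U (fun y => normc (F y) ^+ 2).
Proof.
move=> oU [rF iF _] k.
apply: (Ck_eq oU) (CkD oU (CkM oU (rF k) (rF k)) (CkM oU (iF k) (iF k))) => x _.
rewrite !fctE /reF /imF; case: (F x) => a b /=.
by rewrite sqr_sqrtr ?addr_ge0 ?sqr_ge0 // !expr2.
Qed.

Variables (U : set V) (G : V -> 'M[C]_n) (F A w : V -> C).
Hypothesis oU : open U.
Hypothesis holoG : forall a b, holomorphic_on U (fun y => G y a b).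
Hypothesis detG : forall x, U x -> \det (G x) != 0.
Hypothesis holoF : holomorphic_on U F.
Hypothesis F0 : forall x, U x -> F x != 0.
Hypothesis holoA : holomorphic_on U A.
Hypothesis holow : holomorphic_on U w.

Let Z y := (F y)^-1 *: sharp (G y) (\row_j dz j F y).
Let u y := normc (F y) ^+ 2.
Let X (B : 'M[C]_n -> V -> V -> R) (y : V) : V :=
  (u y)^-1 *: sharp (gram (B (G y))) (\row_a 'D_(e_ R a) u y).
Let E x := \sum_j dz j (fun y => A y * w y * Z y 0 j) x.
Let dens B c y :=
  (normc (A y) ^+ 2)%:C * (w y * (w y)^*%C) * realvec (X B y) 0 c.

Lemma CkC_log_gradient k j : CkC k U (fun y => Z y 0 j).
Proof.
have C1 : CkC k U (fun y => (F y)^-1 * \sum_a dz a F y * invmx (G y) j a).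
  apply: CkCM => //; first by apply: CkCV => //; exact: holomorphic_CkC.
  apply: CkC_sum => // a; apply: CkCM => //.
    by apply: CkC_dz => //; exact: holomorphic_CkC.
  by apply: CkC_invmx => // *; exact: holomorphic_CkC.
apply: CkC_eq C1 => // y _; rewrite !mxE; congr (_ * _).
by apply: eq_bigr => a _; rewrite !mxE.
Qed.

Lemma CkC_mult_gradient k j : CkC k U (fun y => A y * w y * Z y 0 j).
Proof.
apply: CkCM => //; last exact: CkC_log_gradient.
by apply: CkCM => //; exact: holomorphic_CkC.
Qed.

Let scaled_covector y : U y ->
  (u y)^-1%:C *: covector10 (\row_a 'D_(e_ R a) u y) =
  (F y)^-1 *: \row_j dz j F y.
Proof.
move=> Uy; have [_ _ CR] := holoF.
rewrite covector10_sqmod; last exact: CR.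
  rewrite scalerA; congr (_ *: _).
  have -> : (u y)^-1%:C = (F y * (F y)^*%C)^-1.
    by rewrite -normc_sqrE -/(u y) fmorphV.
  by rewrite invfM -mulrA mulVf ?mulr1 // conjc_eq0 F0.
by apply: CkC_differentiable (holomorphic_CkC 1 holoF) Uy.
Qed.

(** On (1,0)-parts both normalized real gradients are multiples of grad_g (log f):
    d(f conj f)^{1,0} / |f|^2 = df / f because conj f is antiholomorphic, and the
    twin metric, being that of i g, adds a factor 1/i. *)
Lemma zc_real_gradient y : U y -> zc (X (@real_bil R n) y) = Z y.
Proof.
move=> Uy; rewrite zcZ zc_sharp_real ?detG // -sharpZ scaled_covector //.
by rewrite sharpZ.
Qed.

Lemma zc_twin_gradient y : U y -> zc (X (@twin_bil R n) y) = - 'i *: Z y.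
Proof.
move=> Uy; rewrite zcZ zc_sharp_twin ?detG // scalerA mulrC -scalerA.
by rewrite -sharpZ scaled_covector // sharpZ.
Qed.

Lemma divergence_real_gradient B (lam : C) :
  (forall y, U y -> zc (X B y) = lam *: Z y) ->
  forall x, U x ->
  let q := (A x * w x)^*%C * E x in
  (forall c, differentiableC (dens B c) x) /\
  \sum_c dw c (dens B c) x = lam * q + (lam * q)^*%C.
Proof.
move=> XZ x Ux q.
have Uxn : nbhs x U by exact: open_nbhs_nbhs.
have dA : differentiableC A x :=
  CkC_differentiable (holomorphic_CkC 1 holoA) Ux.
have diffw : differentiableC w x :=
  CkC_differentiable (holomorphic_CkC 1 holow) Ux.
apply: (@sum_dw_real_field _ _ (fun y => A y * w y) Z).
- exact: differentiableCM.
- move=> j; have [_ _ /(_ _ Ux j) A0] := holoA.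
  have [_ _ /(_ _ Ux j) w0] := holow.
  by rewrite -dw_r dwM // !dw_r A0 w0 mul0r mulr0 addr0.
- move=> j; exact: CkC_differentiable (CkC_mult_gradient 1 j) Ux.
- by near=> y; rewrite normc_sqrE mulrACA -conjcM.
- by apply: filterS Uxn => y; exact: XZ.
Unshelve. all: by end_near.
Qed.

Let real1 y : U y -> zc (X (@real_bil R n) y) = 1 *: Z y.
Proof. by move=> Uy; rewrite scale1r zc_real_gradient. Qed.

Lemma differentiableC_gradients x : U x ->
  (forall c, differentiableC (dens (@real_bil R n) c) x) /\
  (forall c, differentiableC (dens (@twin_bil R n) c) x).
Proof.
move=> Ux; split; first exact: (divergence_real_gradient real1 Ux).1.
exact: (divergence_real_gradient zc_twin_gradient Ux).1.
Qed.

(** With q = conj(A w) div (A w Z), the two real divergences are 2 Re q and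
    2 Re (- i q), and q vanishes when its real and imaginary parts do. *)
Lemma divergences_eq0 :
  (forall x, U x -> E x = 0) <->
  (forall x, U x -> \sum_c dw c (dens (@real_bil R n) c) x = 0) /\
  (forall x, U x -> \sum_c dw c (dens (@twin_bil R n) c) x = 0).
Proof.
split=> [E0|[Eh Ek]].
  split=> x Ux.
    by rewrite (divergence_real_gradient real1 Ux).2 E0 // !mulr0 conjc0 addr0.
  rewrite (divergence_real_gradient zc_twin_gradient Ux).2 E0 //.
  by rewrite !mulr0 conjc0 addr0.
apply: div_eq0 => //; first by move=> j; exact: CkC_mult_gradient.
move=> x Ux; apply: re_im_eq0.
  by have := Eh x Ux; rewrite (divergence_real_gradient real1 Ux).2 mul1r.
by have := Ek x Ux; rewrite (divergence_real_gradient zc_twin_gradient Ux).2.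
Qed.
End Chart.

Section LastMultipliers.
Local Open Scope complex_scope.
Local Open Scope classical_set_scope.
Variables (R : realType) (n : nat) (M : complexManifold R n.+1).
Variables (g : holoMetric M) (w : metricVolume g).

Lemma holo_last_multiplierP (alpha : M -> R[i]) (Z : hfield M) :
  holomorphic alpha ->
  (forall i j x, chart_im i x ->
    differentiableC (fun y => alpha (chart_inv i y) * w i y * Z i y 0 j) x) ->
  holo_last_multiplier w alpha Z <->
  forall i x, chart_im i x ->
    \sum_j dz j (fun y => alpha (chart_inv i y) * w i y * Z i y 0 j) x = 0.
Proof.
move=> ha dZ; split=> [[_ H] i x Ux|H].
  by apply/(del_interior (fun j => dZ i j x Ux)); exact: H.
by split=> // i x Ux; apply/(del_interior (fun j => dZ i j x Ux)); exact: H.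
Qed.

Lemma real_last_multiplierP (m : M -> R) (X : rfield M) :
  smooth m ->
  (forall i c x, chart_im i x -> differentiableC (fun y =>
    (m (chart_inv i y))%:C * (w i y * (w i y)^*%C) * realvec (X i y) 0 c) x) ->
  real_last_multiplier w m X <->
  forall i x, chart_im i x ->
    \sum_c dw c (fun y =>
      (m (chart_inv i y))%:C * (w i y * (w i y)^*%C) * realvec (X i y) 0 c) x = 0.
Proof.
move=> sm dX; split=> [[_ H] i x Ux|H].
  by apply/(extd_interior (fun j => dX i j x Ux)); exact: H.
by split=> // i x Ux; apply/(extd_interior (fun j => dX i j x Ux)); exact: H.
Qed.
End LastMultipliers.

Theorem theorem2p2 (R : realType) (n : nat) (M : complexManifold R n)
    (g : holoMetric M) (w : metricVolume g) (f alpha : M -> R[i])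
    (f_holo : holomorphic f) (f_neq0 : forall p : M, f p != 0)
    (alpha_holo : holomorphic alpha) :
  holo_last_multiplier w alpha (hgrad_log g f) <->
  real_last_multiplier w (sqmod alpha)
    (scale_field (fun p => (sqmod f p)^-1) (grad_h g (sqmod f))) /\
  real_last_multiplier w (sqmod alpha)
    (scale_field (fun p => (sqmod f p)^-1) (grad_k g (sqmod f))).
Proof.
have sm : smooth (sqmod alpha).
  by move=> i; apply: smooth_sqnorm; [exact: chart_im_open|exact: alpha_holo].
case: n M g w f alpha f_holo f_neq0 alpha_holo sm =>
  [|n] M g w f alpha f_holo f_neq0 alpha_holo sm.
  (* In dimension 0 there are no directions to differentiate along. *)
  have ddir0 (v : 'rV[R[i]]_(0 + 0)) F x : ddir v F x = 0.
    by rewrite /ddir big_ord0.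
  split=> [_|_].
    by split; split=> // i x _ v; rewrite /extd big1 // => a _;
      rewrite ddir0 mulr0.
  by split=> // i x _ v; rewrite /del big1 // => a _; rewrite ddir0 mulr0.
have oU i : open (chart_im (M := M) i) by exact: chart_im_open.
have F0 i x : chart_im i x -> (f \o chart_inv i) x != 0.
  by move=> _; exact: f_neq0.
have div0 i := divergences_eq0 (oU i) (gmx_holo g i) (@gmx_nondeg _ _ _ g i)
  (f_holo i) (F0 i) (alpha_holo i) (wco_holo w i).
have dX i := differentiableC_gradients (oU i) (gmx_holo g i)
  (@gmx_nondeg _ _ _ g i) (f_holo i) (F0 i) (alpha_holo i) (wco_holo w i).
rewrite holo_last_multiplierP //; last first.
  move=> i j x; apply: CkC_differentiable; exact: (CkC_mult_gradient (oU i)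
    (gmx_holo g i) (@gmx_nondeg _ _ _ g i) (f_holo i) (F0 i) (alpha_holo i)
    (wco_holo w i) 1).
have Eh := real_last_multiplierP (w := w) sm
  (X := scale_field (fun p => (sqmod f p)^-1) (grad_h g (sqmod f)))
  (fun i c x Ux => (dX i x Ux).1 c).
have Ek := real_last_multiplierP (w := w) sm
  (X := scale_field (fun p => (sqmod f p)^-1) (grad_k g (sqmod f)))
  (fun i c x Ux => (dX i x Ux).2 c).
split=> [H|[/Eh Hh /Ek Hk] i].
  split; first by apply/Eh => i; exact: ((div0 i).1 (H i)).1.
  by apply/Ek => i; exact: ((div0 i).1 (H i)).2.
by apply: (div0 i).2; split; [exact: Hh|exact: Hk].
Qed.
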